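(* Let $\sigma\ge 1$ and $n\ge 1$ be integers and let $\Sigma$ be a totally ordered alphabet of size $\sigma$. Let $ED(\sigma,n)$ be the expected number of distinct Lyndon factors in a uniformly random word of length $n$ over $\Sigma$, i.e. $\sigma^{-n}$ times the sum over all $w\in\Sigma^n$ of the number of distinct Lyndon factors of $w$. Then $$ED(\sigma,n)=\sum_{m=1}^{n}\frac{1}{m}\sum_{d\mid m}\mu\!\left(\frac{m}{d}\right)\sigma^{d}\sum_{s=1}^{\lfloor n/m\rfloor}(-1)^{s+1}\binom{n-sm+s}{s}\sigma^{-sm}.$$
   Context: $\mu$ denotes the M\''obius function. $\Sigma^n$ is the set of words of length $n$ over $\Sigma$; words are compared by the lexicographic order induced by the order on $\Sigma$. A word $z$ is a factor of $w$ if $w=uzv$ for some (possibly empty) words $u,v$ (so $w$ is a factor of itself). A word is primitive if it is non-empty and is not a power $x^k$, $k\ge 2$, of a shorter word $x$. Two words $u,v$ are conjugate if $u=xy$ and $v=yx$ for some words $x,y$. A Lyndon word is a non-empty primitive word that is lexicographically least in its conjugacy class (equivalently, a non-empty word that is a single letter or is strictly smaller than each of its non-empty proper suffixes). A Lyndon factor of $w$ is a factor of $w$ that is a Lyndon word; the number of distinct Lyndon factors counts each such word once regardless of how often it occurs. *)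

(* Defs.v *)
From HB Require Import structures.
From mathcomp Require Import all_boot all_order all_algebra.

Set Implicit Arguments.
Unset Strict Implicit.
Unset Printing Implicit Defensive.

Import Order.TTheory GRing.Theory Num.Theory.

Local Open Scope ring_scope.

(* Only the values at k > 0 are meaningful. *)
Definition mobius (k : nat) : int :=
  if all (fun p => logn p k == 1%N) (primes k) then (-1) ^+ size (primes k)
  else 0.

Definition word_pow (T : Type) (x : seq T) (k : nat) : seq T :=
  flatten (nseq k x).

(* The quantifiers are bounded only to obtain a boolean; [primitiveP] is the
   unbounded form. *)
Definition primitive (T : finType) (z : seq T) : bool :=
  (z != [::]) &&
  ~~ [exists x : (size z).-bseq T, exists k : 'I_(size z).+1,
       [&& 2 <= k, size x < size z & z == word_pow x k]%N].

Definition conjugate (T : eqType) (u v : seq T) : bool :=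
  [exists i : 'I_(size u).+1, v == rot i u].

Definition lexi_le (d : Order.disp_t) (T : porderType d) (u v : seq T) : bool :=
  ((u : seqlexi T) <= (v : seqlexi T))%O.

(* All the conjugates of z have the length of z. *)
Definition lyndon (d : Order.disp_t) (T : finOrderType d) (z : seq T) : bool :=
  primitive z &&
  [forall v : (size z).-tuple T, conjugate z v ==> lexi_le z v].

(* The factors of w have length at most size w, so each of them occurs exactly
   once in the finite type (size w).-bseq T. *)
Definition num_lyndon_factors (d : Order.disp_t) (T : finOrderType d)
    (w : seq T) : nat :=
  #|[set z : (size w).-bseq T | infix z w && lyndon z]|.

Definition ED (d : Order.disp_t) (T : finOrderType d) (n : nat) : rat :=
  #|T|%:R ^- n * \sum_(w : n.-tuple T) (num_lyndon_factors w)%:R.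

Lemma size_word_pow (T : Type) (x : seq T) (k : nat) :
  size (word_pow x k) = (k * size x)%N.
Proof. by elim: k => //= k IHk; rewrite size_cat IHk mulSn. Qed.

Lemma primitiveP (T : finType) (z : seq T) :
  reflect (z <> [::] /\
           ~ exists (x : seq T) (k : nat),
               [/\ (2 <= k)%N, (size x < size z)%N & z = word_pow x k])
          (primitive z).
Proof.
apply: (iffP andP) => -[/eqP z0 pz]; split => //; last first.
  apply/negP => /existsP[x /existsP[k /and3P[k2 xz /eqP zE]]].
  by apply: pz; exists x, k.
case=> x [k [k2 xz zE]]; move/negP: pz; apply.
have sz : size z = (k * size x)%N by rewrite {1}zE size_word_pow.
have x0 : (0 < size x)%N.
  rewrite lt0n; apply/eqP => x0; apply/z0/size0nil.
  by rewrite sz x0 muln0.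
have kz : (k < (size z).+1)%N by rewrite ltnS sz leq_pmulr.
apply/existsP; exists (Bseq (ltnW xz)).
apply/existsP; exists (Ordinal kz).
by rewrite /= k2 xz -zE eqxx.
Qed.

Lemma conjugateP (T : eqType) (u v : seq T) :
  reflect (exists x y : seq T, u = x ++ y /\ v = y ++ x) (conjugate u v).
Proof.
apply: (iffP existsP) => [[i /eqP ->]|[x [y [-> ->]]]].
  by exists (take i u), (drop i u); rewrite cat_take_drop.
have xi : (size x < (size (x ++ y)).+1)%N by rewrite ltnS size_cat leq_addr.
by exists (Ordinal xi); rewrite /= rot_size_cat.
Qed.

Lemma lyndonP (d : Order.disp_t) (T : finOrderType d) (z : seq T) :
  reflect (primitive z /\ forall v : seq T, conjugate z v -> lexi_le z v)
          (lyndon z).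
Proof.
apply: (iffP andP) => -[pz lz]; split=> //.
  move=> v czv; have /existsP[i /eqP vE] := czv.
  have sv : size v == size z by rewrite vE size_rot.
  by move/forallP/(_ (Tuple sv))/implyP: lz; apply.
by apply/forallP => v; apply/implyP => /lz.
Qed.

(* Main.v *)
Require Import Defs.
From mathcomp Require Import all_boot all_order all_algebra.
From mathcomp Require Import zify ring.

Set Implicit Arguments.
Unset Strict Implicit.
Unset Printing Implicit Defensive.

Import Order.TTheory GRing.Theory Num.Theory.
Local Open Scope ring_scope.

(** Summing over Lyndon words first, ED T n is the sum over the lengths m of the
    number of Lyndon words of length m times the proportion of words of length n
    that contain a given one. This proportion depends on the length only.

    A Lyndon word z is unbordered ([lyndon_unbordered]), so its occurrences in a
    word never overlap. Writing N n for the number of words of length n that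
    avoid z and q for the size of the alphabet, adding a letter in front of a
    word that avoids z gives q * N n = N n.+1 + N (n.+1 - m)
    ([num_avoidingS]), and the alternating binomial sum is the solution of this
    recurrence ([num_avoidingE]). Its term s is the inclusion-exclusion
    contribution of the s-subsets of the occurrences of z; the term s = 0 counts
    all the words, hence the sign change and the range starting at 1 when words
    containing z are counted ([sum_infix]).

    Rotation by one letter acts on the words of length m. A word is primitive
    when its orbit has m elements ([primitive_order]), and then the orbit
    contains a single Lyndon word, so there are m times as many primitive words
    as Lyndon words ([card_lyndon]). For e dividing m, the rotation by e letters
    fixes exactly the words whose orbit size divides e, and q ^ e words in all
    ([card_rot_fixed]); Moebius inversion then counts the primitive words
    ([card_primitive]). *)

(** * Moebius inversion *)

Lemma mobius_primeM (p k : nat) : prime p -> (0 < k)%N ->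
  mobius (p * k) = if (p %| k)%N then 0 else - mobius k.
Proof.
move=> p_pr k0; have p0 := prime_gt0 p_pr; rewrite /mobius.
case: (boolP (p %| k)%N) => [pk|npk].
  rewrite ifN //; apply/allPn; exists p.
    by rewrite primesM // primes_prime // inE eqxx.
  by rewrite lognM // logn_prime // eqxx eqSS -lt0n logn_gt0 mem_primes p_pr k0.
have pkE : perm_eq (primes (p * k)) (p :: primes k).
  apply: uniq_perm; rewrite ?primes_uniq //=.
    by rewrite primes_uniq andbT mem_primes p_pr k0.
  by move=> q; rewrite primesM // primes_prime // !inE.
rewrite (perm_all _ pkE) (perm_size pkE) /= lognM // logn_prime // eqxx.
rewrite lognE (negPf npk) !andbF /=.
rewrite (eq_in_all (a2 := fun q => logn q k == 1%N)); last first.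
  move=> q; rewrite mem_primes => /and3P[q_pr _ qk].
  rewrite lognM // logn_prime //; case: (eqVneq q p) => // qp.
  by rewrite -qp qk in npk.
by case: ifP; rewrite ?oppr0 // exprS mulN1r.
Qed.

(** Pairing each divisor prime to a prime factor p with its multiple by p
    cancels all the terms but those divisible by the square of p, which
    vanish. *)
Lemma sum_mobius (k : nat) : (0 < k)%N ->
  \sum_(e <- divisors k) mobius e = (k == 1%N)%:R.
Proof.
move=> k0; case: eqVneq => [->|k1].
  by rewrite (_ : divisors 1 = [:: 1%N]) // big_seq1.
have k_gt1 : (1 < k)%N by rewrite ltn_neqAle eq_sym k1.
have p_pr := pdiv_prime k_gt1; set p := pdiv k in p_pr.
have p0 := prime_gt0 p_pr.
have [q kE] : exists q, k = (p * q)%N.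
  by have /dvdnP[q ->] := pdiv_dvd k; exists q; rewrite mulnC.
have q0 : (0 < q)%N by move: k0; rewrite kE muln_gt0 p0.
rewrite (bigID (fun e => (p %| e)%N)) /= -big_filter.
rewrite (perm_big [seq (p * e)%N | e <- divisors q]) /=; last first.
  apply: uniq_perm.
  - by rewrite filter_uniq // divisors_uniq.
  - rewrite map_inj_uniq ?divisors_uniq // => x y /eqP.
    by rewrite eqn_pmul2l // => /eqP.
  move=> e; rewrite mem_filter -dvdn_divisors //; apply/andP/mapP.
    case=> /dvdnP[f ->]; rewrite mulnC kE dvdn_pmul2l // => fq.
    by exists f; rewrite // -dvdn_divisors.
  by case=> f; rewrite -dvdn_divisors // => fq ->; rewrite dvdn_mulr // kE dvdn_pmul2l.
rewrite big_map (bigID (fun e => (p %| e)%N)) /= big_seq_cond big1 ?add0r; last first.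
  move=> e /andP[]; rewrite -dvdn_divisors // => eq pe.
  by rewrite mobius_primeM ?pe // (dvdn_gt0 q0 eq).
rewrite [X in X + _](_ : _ =
    - \sum_(e <- divisors q | ~~ (p %| e)%N) mobius e); last first.
  rewrite -sumrN big_seq_cond [RHS]big_seq_cond; apply: eq_bigr => e.
  move=> /andP[]; rewrite -dvdn_divisors // => eq pe.
  by rewrite mobius_primeM ?(dvdn_gt0 q0 eq) // (negPf pe).
apply/eqP; rewrite addrC subr_eq0 -big_filter -[X in _ == X]big_filter; apply/eqP.
apply: perm_big; apply: uniq_perm; rewrite ?filter_uniq ?divisors_uniq //.
move=> e; rewrite !mem_filter -!dvdn_divisors // kE.
case pe: (p %| e)%N => //=; rewrite Gauss_dvdr //.
by rewrite coprime_sym prime_coprime // pe.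
Qed.

(** Reindexing by m %/ e turns this into the sum of mobius over the divisors of
    m %/ r. In this form, inverting a sum over divisors amounts to exchanging two
    summations. *)
Lemma sum_mobius_multiples (m r : nat) : (0 < m)%N -> (r %| m)%N ->
  \sum_(e <- divisors m | (r %| e)%N) mobius (m %/ e) = (r == m)%:R.
Proof.
move=> m0 /dvdnP[q mE].
have /andP[q0 r0] : (0 < q)%N && (0 < r)%N by rewrite -muln_gt0 -mE.
have -> : (r == m) = (q == 1%N).
  by rewrite mE -{1}[r]mul1n eqn_pmul2r // eq_sym.
rewrite -sum_mobius // -big_filter.
rewrite (perm_big [seq (m %/ f)%N | f <- divisors q]) /=; last first.
  apply: uniq_perm.
  - by rewrite filter_uniq // divisors_uniq.
  - rewrite map_inj_in_uniq ?divisors_uniq // => x y.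
    rewrite -!dvdn_divisors // => xq yq mxy.
    have xm : (x %| m)%N by rewrite mE dvdn_mulr.
    have ym : (y %| m)%N by rewrite mE dvdn_mulr.
    apply/eqP; rewrite -(eqn_pmul2l (m := m %/ x)); last first.
      by rewrite divn_gt0 ?(dvdn_leq m0) // (dvdn_gt0 m0).
    by rewrite {2}mxy !divnK.
  move=> e; rewrite mem_filter -dvdn_divisors //; apply/andP/mapP.
    case=> /dvdnP[f ->]; rewrite mE dvdn_pmul2r // => fq.
    have f0 := dvdn_gt0 q0 fq.
    exists (q %/ f)%N; first by rewrite -dvdn_divisors // dvdn_div.
    rewrite -{1}(divnK fq) -mulnA mulKn // divn_gt0 //.
    exact: dvdn_leq.
  case=> f; rewrite -dvdn_divisors // => fq ->.
  by rewrite mE -divn_mulAC // dvdn_mull // dvdn_mul // dvdn_div.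
rewrite big_map big_seq [RHS]big_seq; apply: eq_bigr => f.
rewrite -dvdn_divisors // => fq.
have fm : (f %| m)%N by rewrite mE dvdn_mulr.
by rewrite divnA // mulKn.
Qed.

(** * Words that avoid an unbordered word *)

(** A word u that is both a prefix and a suffix of z is trivial; x = [::] means
    that u is z itself. *)
Definition unbordered (T : Type) (z : seq T) : Prop :=
  forall u x y, z = u ++ x -> z = y ++ u -> u = [::] \/ x = [::].

(** A second occurrence of z in z ++ v cannot overlap the first one, the overlap
    being a border of z. *)
Lemma infix_behead_cat (T : eqType) (z v : seq T) : z != [::] -> unbordered z ->
  infix z (behead (z ++ v)) = infix z v.
Proof.
move=> z0 unb; apply/idP/idP => [|zv]; last first.
  by case: z z0 unb zv => //= a z _ _ /infix_trans; apply; apply: suffix_infix.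
case: z z0 unb => //= a s _; set z := a :: s => unb /infixP[p [q E]].
case: (leqP (size s) (size p)) => ps.
  apply/infixP; exists (drop (size s) p), q.
  have := congr1 (drop (size s)) E.
  rewrite [LHS]drop_size_cat // drop_cat ltn_neqAle ps andbT.
  by case: eqVneq => // ->; rewrite subnn drop0 drop_size.
(* The end of s that follows p is the part common to both occurrences. *)
have sE : s = p ++ drop (size p) s.
  have := congr1 (take (size p)) E; rewrite [RHS]take_size_cat // take_cat ps => pE.
  by rewrite -{1}pE cat_take_drop.
set u := drop (size p) s in sE.
have uv : u ++ v = z ++ q.
  by have := E; rewrite {1}sE -catA => /eqP; rewrite eqseq_cat // eqxx => /eqP.
have usz : (size u <= size z)%N by rewrite size_drop /=; lia.
have zE : z = u ++ drop (size u) z.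
  have := congr1 (take (size u)) uv; rewrite [LHS]take_size_cat // take_cat.
  rewrite ltn_neqAle usz andbT; case: (eqVneq (size u) (size z)) => /= szu.
    by rewrite size_drop /= in szu; lia.
  by move=> uE; rewrite {1}uE cat_take_drop.
have [u0|/(congr1 size)] := unb _ _ (a :: p) zE (congr1 (cons a) sE).
  by move: ps; have := congr1 size sE; rewrite size_cat u0 /=; lia.
by rewrite size_drop /= size_drop; lia.
Qed.

Section SumTuples.
Variables (T : finType) (R : nmodType).
Implicit Type F : seq T -> R.

Lemma sum_tuple0 F : \sum_(w : 0.-tuple T) F w = F [::].
Proof.
rewrite (bigD1 [tuple]) //= big1 ?addr0 // => w.
by rewrite (tuple0 w) => /eqP.
Qed.

Lemma sum_tupleS n F :
  \sum_(w : n.+1.-tuple T) F w = \sum_a \sum_(w : n.-tuple T) F (a :: w).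
Proof.
rewrite pair_bigA /=.
rewrite (reindex (fun p : T * n.-tuple T => [tuple of p.1 :: p.2])) //=.
exists (fun w : n.+1.-tuple T => (thead w, [tuple of behead w])) => [[a w] _|w _].
  by congr pair; apply: val_inj.
by rewrite -tuple_eta.
Qed.

Lemma sum_tupleD m n F :
  \sum_(w : (m + n).-tuple T) F w =
  \sum_(u : m.-tuple T) \sum_(v : n.-tuple T) F (u ++ v).
Proof.
elim: m F => [|m IHm] F.
  by rewrite (sum_tuple0 (fun u => \sum_(v : n.-tuple T) F (u ++ v))).
rewrite (sum_tupleS m (fun u => \sum_(v : n.-tuple T) F (u ++ v))).
rewrite addSn sum_tupleS; apply: eq_bigr => a _.
exact: IHm (fun w => F (a :: w)).
Qed.

End SumTuples.

Definition num_avoiding (T : finType) (z : seq T) (n : nat) : nat :=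
  \sum_(w : n.-tuple T) ~~ infix z w.

Lemma num_avoiding0 (T : finType) (z : seq T) :
  z != [::] -> num_avoiding z 0 = 1%N.
Proof.
move=> z0; rewrite /num_avoiding (sum_tuple0 (fun w => nat_of_bool (~~ infix z w))).
by rewrite infixs0 (negPf z0).
Qed.

(** Put a letter in front of a word that avoids z: either the longer word avoids
    z too, or its only occurrence of z is at its start, in which case what
    follows that occurrence is an arbitrary word that avoids z. *)
Lemma num_avoidingS (T : finType) (z : seq T) (n : nat) :
  z != [::] -> unbordered z ->
  (#|T| * num_avoiding z n =
   num_avoiding z n.+1 +
   if size z <= n.+1 then num_avoiding z (n.+1 - size z) else 0)%N.
Proof.
move=> z0 unb.
pose one_start w := prefix z w && ~~ infix z (behead w).
have -> : (#|T| * num_avoiding z n =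
           num_avoiding z n.+1 + \sum_(w : n.+1.-tuple T) one_start w)%N.
  rewrite -sum_nat_const -big_split /=.
  rewrite (sum_tupleS n (fun w => ~~ infix z w + one_start w)%N).
  apply: eq_bigr => a _; apply: eq_bigr => w _.
  by rewrite infix_consl /one_start; case: (prefix _ _); case: (infix z w).
congr addn; case: leqP => [zn|zn]; last first.
  rewrite big1 // => w _; rewrite /one_start; case: prefixP => // -[v vE].
  by have := congr1 size vE; rewrite size_cat size_tuple => szw; have := leq_addr (size v) (size z); rewrite -szw leqNgt zn.
have [k ->] : exists k, n.+1 = (size z + k)%N by exists (n.+1 - size z)%N; rewrite subnKC.
rewrite addKn (sum_tupleD (size z) k (fun w => nat_of_bool (one_start w))).
rewrite exchange_big; apply: eq_bigr => v _ /=.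
rewrite (bigD1 (in_tuple z)) //= {1}/one_start prefix_prefix infix_behead_cat //.
rewrite big1 => [|u uz]; first exact: addn0.
rewrite /one_start.
case: prefixP => // -[v' E]; case/eqP: uz; apply: val_inj => /=.
by have /eqP := E; rewrite eqseq_cat ?size_tuple // => /andP[/eqP].
Qed.

(** The inclusion-exclusion contribution of the sets of s occurrences of a word
    of length m in the words of length n over q letters, when occurrences cannot
    overlap: 'C(n - s * m + s, s) counts the ways to place s blocks among the
    n - s * m letters left free. The test keeps the truncated subtraction from
    producing spurious terms. *)
Definition placement_term (R : pzRingType) (q m n s : nat) : R :=
  if (s * m <= n)%N then
    (-1) ^+ s * 'C(n - s * m + s, s)%:R * q%:R ^+ (n - s * m)
  else 0.

(** By Pascal's rule, each term obeys the recurrence of [num_avoidingS]. When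
    n.+1 = s.+1 * m no letter is free: the term for n vanishes and both binomials
    that remain are 1. *)
Lemma placement_termS (R : comPzRingType) (q m n s : nat) : (0 < m)%N ->
  placement_term R q m n.+1 s.+1 =
  q%:R * placement_term R q m n s.+1 -
  (if (m <= n.+1)%N then placement_term R q m (n.+1 - m) s else 0).
Proof.
move=> m0; rewrite /placement_term.
have -> : (s.+1 * m <= n.+1)%N = (m <= n.+1)%N && (s * m <= n.+1 - m)%N.
  by rewrite mulSn; lia.
case: (leqP m n.+1) => [mn|mn]; last first.
  by rewrite ifN ?mulr0 ?subr0 // -ltnNge mulSn; lia.
case: (leqP (s * m) (n.+1 - m)) => [smn|smn]; last first.
  by rewrite ifN ?mulr0 ?subr0 // -ltnNge mulSn; lia.
have -> : (n.+1 - s.+1 * m = n.+1 - m - s * m)%N by rewrite mulSn; lia.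
rewrite addnS binS natrD.
case: leqP => [smn'|smn'].
  have -> : (n - s.+1 * m + s.+1 = n.+1 - m - s * m + s)%N.
    by move: smn'; rewrite mulSn; lia.
  have -> : (n.+1 - m - s * m = (n - s.+1 * m).+1)%N.
    by move: smn'; rewrite mulSn; lia.
  by rewrite !exprS; ring.
have -> : (n.+1 - m - s * m = 0)%N by move: smn'; rewrite mulSn; lia.
by rewrite add0n binn bin_small // [(-1) ^+ s.+1]exprS; ring.
Qed.

Lemma num_avoidingE (R : comPzRingType) (T : finType) (z : seq T) (n k : nat) :
  z != [::] -> unbordered z -> (n < k)%N ->
  (num_avoiding z n)%:R = \sum_(s < k) placement_term R #|T| (size z) n s.
Proof.
move=> z0 unb; have m0 : (0 < size z)%N by rewrite lt0n size_eq0.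
elim/ltn_ind: n k => -[_|n IHn] k nk.
  case: k nk => // k _; rewrite num_avoiding0 // big_ord_recl big1 => [|s _].
    by rewrite /placement_term /= mul0n subnn bin0 !expr0 !mulr1 addr0.
  by rewrite /placement_term ifN //= -ltnNge muln_gt0.
case: k nk => // k nk.
have := num_avoidingS n z0 unb.
move/(congr1 (fun a : nat => a%:R : R)); rewrite natrD natrM => /eqP.
rewrite (IHn n (ltnSn n) k.+1 (ltnW nk)) -subr_eq => /eqP <-.
rewrite !big_ord_recl mulrDr -addrA; congr (_ + _).
  by rewrite /placement_term /= !mul0n !subn0 !addn0 !bin0 !expr0 !mul1r exprS.
under [RHS]eq_bigr do rewrite placement_termS //.
rewrite sumrB mulr_sumr; congr (_ - _); case: leqP => [mn|_]; last by rewrite big1.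
by apply: IHn; lia.
Qed.

(** The words containing z are the complement of those avoiding it: the term
    s = 0, which is #|T| ^ n, cancels and the other ones change sign. *)
Lemma sum_infix (T : finType) (z : seq T) (n : nat) :
  z != [::] -> unbordered z ->
  (\sum_(w : n.-tuple T) infix z w)%N%:R =
  \sum_(1 <= s < (n %/ size z).+1)
    (-1) ^+ s.+1 * 'C(n - s * size z + s, s)%:R * #|T|%:R ^+ (n - s * size z) :> rat.
Proof.
move=> z0 unb; have m0 : (0 < size z)%N by rewrite lt0n size_eq0.
have total : (\sum_(w : n.-tuple T) infix z w + num_avoiding z n = #|T| ^ n)%N.
  rewrite -big_split /= -card_tuple -sum1_card; apply: eq_bigr => w _.
  by case: (infix z w).
have -> : (\sum_(w : n.-tuple T) infix z w)%N%:R =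
          (#|T| ^ n)%:R - (num_avoiding z n)%:R :> rat.
  by rewrite -total natrD addrK.
rewrite (num_avoidingE rat z0 unb (ltnSn n)) big_ord_recl.
rewrite {1}/placement_term /= mul0n subn0 bin0 expr0 !mul1r natrX opprD addNKr.
rewrite -sumrN big_add1 /=.
rewrite -(big_mkord xpredT (fun s => - placement_term rat #|T| (size z) n s.+1)).
rewrite (big_cat_nat (n := n %/ size z)) //= ?leq_div //.
rewrite [X in _ + X]big_nat_cond [X in _ + X]big1 ?addr0 => [|s]; last first.
  rewrite andbT => /andP[sn _]; rewrite /placement_term ifN ?oppr0 //.
  by rewrite -leq_divRL // -ltnNge ltnS.
rewrite big_nat_cond [RHS]big_nat_cond; apply: eq_bigr => s.
rewrite andbT => /= sn; rewrite /placement_term -leq_divRL // sn.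
by rewrite [(-1) ^+ s.+2]exprS; ring.
Qed.

(** * Rotations of a word and primitivity *)

Lemma iter_eq_order (T : finType) (f : T -> T) (x : T) (e : nat) :
  injective f -> (iter e f x == x) = (fingraph.order f x %| e)%N.
Proof.
move=> injf; set r := fingraph.order f x.
have iter_mul a : iter (a * r) f x = x.
  by elim: a => //= a IHa; rewrite mulSn iterD IHa iter_order.
rewrite /dvdn {1}(divn_eq e r) addnC iterD iter_mul.
have er : (e %% r < r)%N by rewrite ltn_mod order_gt0.
apply/eqP/eqP => [fx|->//].
by rewrite -(findex_iter er) fx findex0.
Qed.

Definition rot1t (T : Type) (m : nat) (w : m.-tuple T) : m.-tuple T :=
  [tuple of rot 1 w].

Lemma rot1t_inj (T : Type) (m : nat) : injective (@rot1t T m).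
Proof. by move=> u v /(congr1 val) /rot_inj /val_inj. Qed.

Lemma val_iter_rot1t (T : Type) (m e : nat) (w : m.-tuple T) :
  (e <= m)%N -> val (iter e (@rot1t T m) w) = rot e w.
Proof.
elim: e => [|e IHe] em; first by rewrite rot0.
by rewrite iterS /= IHe ?(ltnW em) // [RHS]rotS // size_tuple.
Qed.

Lemma rot_eq_order (T : finType) (m e : nat) (w : m.-tuple T) : (e <= m)%N ->
  (rot e w == w) = (fingraph.order (@rot1t T m) w %| e)%N.
Proof.
move=> em; rewrite -iter_eq_order; last exact: rot1t_inj.
by rewrite -val_eqE /= val_iter_rot1t.
Qed.

Lemma order_rot1t_dvd (T : finType) (m : nat) (w : m.-tuple T) :
  (fingraph.order (@rot1t T m) w %| m)%N.
Proof. by rewrite -rot_eq_order // -{1}(size_tuple w) rot_size. Qed.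

(** Two commuting words u and v with size u dividing size v: v starts with u,
    and what remains of v still commutes with u. *)
Lemma commuting_word_pow (T : Type) (u v : seq T) (k : nat) :
  size v = (k * size u)%N -> u ++ v = v ++ u -> v = word_pow u k.
Proof.
elim: k v => [|k IHk] v; first by move/size0nil.
rewrite mulSn => vk uv.
have vE : v = u ++ drop (size u) v.
  have := congr1 (take (size u)) uv.
  rewrite [LHS]take_size_cat // takel_cat ?vk ?leq_addr // => uE.
  by rewrite {1}uE cat_take_drop.
rewrite {1}vE /word_pow /= -/(word_pow u k); congr (_ ++ _).
apply: IHk; first by rewrite size_drop vk addKn.
have := congr1 (drop (size u)) uv.
by rewrite [LHS]drop_size_cat // {2}vE -catA drop_size_cat // -vE.
Qed.

Lemma word_pow_commute (T : Type) (u : seq T) (k : nat) :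
  u ++ word_pow u k = word_pow u k ++ u.
Proof. by elim: k => [|k IHk]; rewrite /= ?cats0 // -catA -IHk. Qed.

Lemma rot_word_pow (T : Type) (u : seq T) (k : nat) :
  rot (size u) (word_pow u k) = word_pow u k.
Proof.
case: k => [|k]; first by rewrite /rot /=.
by rewrite /word_pow /= rot_size_cat [RHS]word_pow_commute.
Qed.

Lemma rot_eq_word_pow (T : Type) (w : seq T) (e k : nat) :
  (0 < k)%N -> size w = (k * e)%N -> rot e w = w -> w = word_pow (take e w) k.
Proof.
case: k => // k _ wk rw.
have et : size (take e w) = e by rewrite size_takel // wk mulSn leq_addr.
have rE : take e w ++ drop e w = drop e w ++ take e w.
  by rewrite cat_take_drop -{1}rw.
rewrite -{1}(cat_take_drop e w) [word_pow _ k.+1]/=; congr (_ ++ _).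
by apply: commuting_word_pow => //; rewrite et size_drop wk mulSn addKn.
Qed.

(** If the orbit has r < m elements then rotation by r letters fixes w, which is
    thus a power of its prefix of length r; conversely a proper power is fixed by
    the rotation by the length of its root. *)
Lemma primitive_order (T : finType) (m : nat) (w : m.-tuple T) : (0 < m)%N ->
  primitive w = (fingraph.order (@rot1t T m) w == m).
Proof.
move=> m0; set r := fingraph.order _ _.
have rm : (r %| m)%N := order_rot1t_dvd w.
have r_le : (r <= m)%N := dvdn_leq m0 rm.
have r0 : (0 < r)%N := order_gt0 _ _.
apply/primitiveP/eqP => [[_ prim]|rmE].
  apply/eqP; rewrite eqn_leq r_le leqNgt; apply/negP => r_lt; case: prim.
    exists (take r w), (m %/ r)%N; rewrite size_takel size_tuple //; split => //.
    by rewrite ltn_divRL // mul1n.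
  apply: rot_eq_word_pow; rewrite ?size_tuple ?divn_gt0 ?divnK //.
  by apply/eqP; rewrite rot_eq_order.
split=> [/(congr1 size)|[x [k [k2 xw wE]]]].
  by rewrite size_tuple /= => m0'; rewrite m0' in m0.
rewrite size_tuple in xw.
have x0 : (0 < size x)%N.
  rewrite lt0n; apply/eqP => x0; have := congr1 size wE.
  by rewrite size_word_pow size_tuple x0 muln0 => m0'; rewrite m0' in m0.
have : (r %| size x)%N by rewrite -rot_eq_order ?(ltnW xw) // wE rot_word_pow.
by rewrite rmE => /(dvdn_leq x0); rewrite leqNgt xw.
Qed.

(** A word of length m fixed by the rotation by a divisor e of m is determined
    by its first e letters, which are arbitrary. *)
Lemma card_rot_fixed (T : finType) (m e : nat) : (0 < m)%N -> (e %| m)%N ->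
  #|[pred w : m.-tuple T | rot e w == w]| = (#|T| ^ e)%N.
Proof.
move=> m0 em; have mE := divnK em; set k := (m %/ e)%N in mE.
have k0 : (0 < k)%N by move: m0; rewrite -mE muln_gt0 => /andP[].
have e_le : (e <= m)%N := dvdn_leq m0 em.
have pow_size (x : e.-tuple T) : size (word_pow x k) == m.
  by rewrite size_word_pow size_tuple mE.
rewrite -card_tuple -(card_imset _ (f := fun x => Tuple (pow_size x))); last first.
  move=> x y /(congr1 (fun w : m.-tuple T => take e w)) /=.
  case: (k) k0 => // k' _; rewrite /word_pow /=.
  by rewrite !take_size_cat ?size_tuple //; apply: val_inj.
apply: eq_card => w; rewrite !inE; apply/eqP/imsetP => [rw|[x _ ->] /=].
  have tw : size (take e w) == e by rewrite size_takel // size_tuple.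
  exists (Tuple tw) => //; apply: val_inj => /=.
  by apply: rot_eq_word_pow; rewrite // size_tuple.
by rewrite -{1}(size_tuple x) rot_word_pow.
Qed.

(** A word w is primitive when the size r of its orbit is m, and the indicator of
    r = m is a sum of mobius over the divisors e of m that r divides, that is,
    those for which the rotation by e letters fixes w. *)
Lemma card_primitive (T : finType) (m : nat) : (0 < m)%N ->
  #|[pred w : m.-tuple T | primitive w]|%:R =
  \sum_(e <- divisors m) mobius (m %/ e) * #|T|%:R ^+ e :> int.
Proof.
move=> m0; rewrite -sum1_card natr_sum big_mkcond /=.
transitivity (\sum_(w : m.-tuple T) \sum_(e <- divisors m)
                mobius (m %/ e) * (rot e w == w)%:R).
  apply: eq_bigr => w _; rewrite unfold_in /= primitive_order //.
  transitivity ((fingraph.order (@rot1t T m) w == m)%:R : int); first by case: eqP.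
  rewrite -sum_mobius_multiples ?order_rot1t_dvd // big_mkcond /=.
  rewrite big_seq [RHS]big_seq; apply: eq_bigr => e.
  rewrite -dvdn_divisors // => /(dvdn_leq m0) em; rewrite rot_eq_order //.
  by case: ifP; rewrite ?mulr1 ?mulr0.
rewrite exchange_big /= big_seq [RHS]big_seq; apply: eq_bigr => e.
rewrite -dvdn_divisors // => em; rewrite -mulr_sumr; congr (_ * _).
rewrite -natrX -(card_rot_fixed T m0 em) -sum1_card natr_sum.
by rewrite [RHS]big_mkcond /=; apply: eq_bigr => w _; rewrite inE; case: eqP.
Qed.

(** * Lyndon words *)

Lemma conjugate_fconnect (T : finType) (m : nat) (u v : m.-tuple T) :
  (0 < m)%N -> conjugate u v = fconnect (@rot1t T m) u v.
Proof.
move=> m0; apply/existsP/idP => [[i /eqP vE]|uv].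
  have im : (i <= m)%N by rewrite -ltnS -{2}(size_tuple u).
  rewrite (_ : v = iter i (@rot1t T m) u); first exact: fconnect_iter.
  by apply: val_inj; rewrite val_iter_rot1t.
have im : (findex (@rot1t T m) u v <= m)%N.
  apply: leq_trans (ltnW (findex_max uv)) _.
  exact: dvdn_leq (order_rot1t_dvd u).
have iu : (findex (@rot1t T m) u v < (size u).+1)%N by rewrite ltnS size_tuple.
exists (Ordinal iu); rewrite /= -{1}(iter_findex uv).
by rewrite -[tval _]/(val _) val_iter_rot1t.
Qed.

Section Lyndon.
Variables (d : Order.disp_t) (T : finOrderType d).
Implicit Types u v x y z : seq T.

Lemma lexi_le_anti u v : lexi_le u v -> lexi_le v u -> u = v.
Proof. by move=> uv vu; apply: (@le_anti _ (seqlexi T)); apply/andP. Qed.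

Lemma lexi_le_catl u x y : lexi_le (u ++ x) (u ++ y) = lexi_le x y.
Proof.
elim: u => //= a u IHu; rewrite -IHu /lexi_le.
by rewrite lexi_cons lexx.
Qed.

Lemma lexi_le_catr x y u v :
  size x = size y -> lexi_le (x ++ u) (y ++ v) -> lexi_le x y.
Proof.
elim: x y => [|a x IHx] [|b y] //= [xy]; rewrite /lexi_le !lexi_cons.
case/andP=> -> /implyP uv; apply/implyP => /uv; exact: IHx.
Qed.

(** If u is a border of z, with z = u ++ x = y ++ u, then comparing z with its
    conjugates x ++ u and u ++ y gives y <= x and x <= y. Hence u and x commute,
    which primitivity forbids unless one of them is empty. *)
Lemma lyndon_unbordered z : lyndon z -> unbordered z.
Proof.
case/lyndonP=> prim zmin u x y zux zyu.
have sxy : size x = size y.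
  have := congr1 size zyu; rewrite {1}zux !size_cat addnC => /eqP.
  by rewrite eqn_add2r => /eqP.
have yx : lexi_le y x.
  apply: (@lexi_le_catr _ _ u u) => //; rewrite -zyu.
  by apply: zmin; apply/conjugateP; exists u, x.
have xy : lexi_le x y.
  rewrite -(lexi_le_catl u) -zux.
  by apply: zmin; apply/conjugateP; exists y, u.
have uxC : u ++ x = x ++ u by rewrite {2}(lexi_le_anti xy yx) -zyu.
case: (eqVneq u [::]) => [|u0]; [by left|right].
apply/eqP; rewrite -size_eq0; apply: contraT; rewrite -lt0n => x0.
have z0 : (0 < size z)%N by rewrite zux size_cat ltn_addl.
have uz : (size u < size z)%N by rewrite zux size_cat -{1}[size u]addn0 ltn_add2l.
have := primitive_order (in_tuple z) z0; rewrite prim => /esym/eqP rz.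
have : (fingraph.order (@rot1t T (size z)) (in_tuple z) %| size u)%N.
  by rewrite -rot_eq_order ?(ltnW uz) //= {1}zux rot_size_cat -uxC -zux.
by rewrite rz => /dvdn_leq; rewrite lt0n size_eq0 u0 leqNgt uz => /(_ isT).
Qed.

Lemma lyndon_tupleP (m : nat) (z : m.-tuple T) : (0 < m)%N ->
  reflect (primitive z /\
           forall v : m.-tuple T, fconnect (@rot1t T m) z v -> lexi_le z v)
          (lyndon z).
Proof.
move=> m0; apply: (iffP (lyndonP _)) => -[prim zmin]; split=> // v zv.
  by apply: zmin; rewrite conjugate_fconnect.
have /eqP sv : size v = m.
  by case/conjugateP: zv => x [y [zE ->]]; rewrite -(size_tuple z) zE !size_cat addnC.
by apply: (zmin (Tuple sv)); rewrite -conjugate_fconnect.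
Qed.

(** Each class of conjugate primitive words of length m consists of m words, one
    of which is its least element. *)
Lemma card_lyndon (m : nat) : (0 < m)%N ->
  (m * #|[pred z : m.-tuple T | lyndon z]| =
   #|[pred w : m.-tuple T | primitive w]|)%N.
Proof.
move=> m0; set f := @rot1t T m; have injf : injective f := @rot1t_inj T m.
have prim_connect (z w : m.-tuple T) : fconnect f z w -> primitive w = primitive z.
  move=> zw; rewrite !primitive_order //; congr (_ == m).
  by apply: eq_card => v; apply/esym/(same_connect (fconnect_sym injf)).
transitivity (\sum_(z : m.-tuple T | lyndon z) \sum_(w : m.-tuple T | primitive w)
                fconnect f z w)%N.
  rewrite mulnC -sum_nat_const; apply: eq_bigr => z; rewrite inE => lz.
  have [prim _] := @lyndon_tupleP m z m0 lz.
  have /eqP {1}<- : fingraph.order f z == m by rewrite -primitive_order.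
  rewrite /fingraph.order -sum1_card [LHS]big_mkcond [RHS]big_mkcond /=.
  apply: eq_bigr => w _; rewrite -[w \in _]/(fconnect f z w).
  by case zw: (fconnect f z w); [rewrite (prim_connect z w) // prim | case: ifP].
rewrite exchange_big -sum1_card /=; apply: eq_bigr => w pw.
pose z := [arg min_(v < w in fconnect f w) (val v : seqlexi T)]%O.
have [wz zmin] : fconnect f w z /\
    forall v : m.-tuple T, fconnect f w v -> lexi_le z v.
  by rewrite /z; case: arg_minP => [|v]; [exact: connect0 | split].
have lz : lyndon z.
  apply/lyndon_tupleP => //; split; first by rewrite (prim_connect _ _ wz).
  by move=> v zv; apply/zmin/(connect_trans wz).
rewrite (bigD1 z) //= fconnect_sym // wz big1 // => v /andP[lv].
apply: contraNeq; rewrite eqb0 negbK => vw; apply/eqP/val_inj.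
have [_ vmin] := @lyndon_tupleP m v m0 lv.
apply: lexi_le_anti; first by apply: vmin; apply: connect_trans vw wz.
by apply: zmin; rewrite fconnect_sym.
Qed.

(** * Expected number of distinct Lyndon factors *)

Lemma sum_bseq (n : nat) (P : pred (seq T)) (F : seq T -> nat) :
  (\sum_(z : n.-bseq T | P z) F z =
   \sum_(m < n.+1) \sum_(z : m.-tuple T | P z) F z)%N.
Proof.
rewrite sig_big_dep (reindex (@tagged_tuple_bseq n T)) //=.
exact/onW_bij/(Bijective tagged_tuple_bseqK bseq_tagged_tupleK).
Qed.

(** Sorting the factors by length makes the outer range independent of w. *)
Lemma num_lyndon_factorsE (n : nat) (w : n.-tuple T) :
  num_lyndon_factors w =
  (\sum_(1 <= m < n.+1) \sum_(z : m.-tuple T | lyndon z) infix z w)%N.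
Proof.
have resize k : k = n -> #|[set z : k.-bseq T | infix z w && lyndon z]| =
                         #|[set z : n.-bseq T | infix z w && lyndon z]| by move->.
rewrite /num_lyndon_factors resize ?size_tuple // -sum1_card.
transitivity (\sum_(z : n.-bseq T | lyndon z) infix z w)%N.
  rewrite big_mkcond [RHS]big_mkcond; apply: eq_bigr => z _.
  by rewrite inE andbC; case: (lyndon z); case: (infix z w).
rewrite (sum_bseq n (@lyndon d T) (fun z => infix z w)).
rewrite -(big_mkord xpredT (fun m => \sum_(z : m.-tuple T | lyndon z) infix z w)%N).
rewrite big_ltn // big1 ?add0n // => z /lyndonP[/primitiveP[+ _] _].
by rewrite tuple0.
Qed.

End Lyndon.

Theorem mainTheorem4 (sigma n : nat) (hsigma : (1 <= sigma)%N) (hn : (1 <= n)%N)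
    (d : Order.disp_t) (T : finOrderType d) (hT : #|T| = sigma) :
  ED T n =
    \sum_(1 <= m < n.+1)
      (m%:R : rat)^-1 *
      \sum_(e <- divisors m)
        (mobius (m %/ e))%:~R * sigma%:R ^+ e *
        \sum_(1 <= s < (n %/ m).+1)
          (-1) ^+ s.+1 * 'C(n - s * m + s, s)%:R * sigma%:R ^- (s * m).
Proof.
rewrite /ED hT -natr_sum.
under eq_bigr do rewrite num_lyndon_factorsE.
rewrite exchange_big natr_sum mulr_sumr big_nat_cond [RHS]big_nat_cond.
apply: eq_bigr => m /andP[/andP[m0 _] _].
have sigma0 : (sigma%:R : rat) != 0 by rewrite pnatr_eq0 -lt0n.
have m_neq0 : (m%:R : rat) != 0 by rewrite pnatr_eq0 -lt0n.
rewrite -mulr_suml exchange_big natr_sum.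
pose c := \sum_(1 <= s < (n %/ m).+1)
  (-1) ^+ s.+1 * 'C(n - s * m + s, s)%:R * sigma%:R ^+ (n - s * m) : rat.
rewrite (eq_bigr (fun _ => c)) => [|z lz]; last first.
  have /primitiveP[/eqP z0 _] : primitive z by case/lyndonP: lz.
  by rewrite sum_infix ?size_tuple ?hT //; apply: lyndon_unbordered.
rewrite sumr_const -[c *+ _]mulr_natl mulrCA.
have num_lyndon : #|[pred z : m.-tuple T | lyndon z]|%:R =
    (m%:R : rat)^-1 * \sum_(e <- divisors m) (mobius (m %/ e))%:~R * sigma%:R ^+ e.
  apply: (mulfI m_neq0); rewrite mulVKf // -natrM card_lyndon //.
  rewrite -[LHS](rmorph_nat (intr : int -> rat)) card_primitive // hT rmorph_sum /=.
  by apply: eq_bigr => e _; rewrite rmorphM rmorphXn /= rmorph_nat.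
rewrite -[#|_|]/#|[pred z : m.-tuple T | lyndon z]| num_lyndon -mulrA.
congr (_ * (_ * _)).
rewrite mulr_sumr big_nat_cond [RHS]big_nat_cond; apply: eq_bigr => s.
rewrite andbT => /andP[_]; rewrite ltnS leq_divRL // => smn.
rewrite mulrCA; congr (_ * _).
by rewrite -{1}(subnK smn) exprD invfM mulrAC mulVf ?mul1r // expf_neq0.
Qed.
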